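(* Let $\lambda\in(1/2,1)$ be the reciprocal of a Garsia number. Let $X=[0,1]^2$, let $S_0,S_1:X\to X$ be given by $S_0(x)=\lambda x$ and $S_1(x)=\lambda x+(1-\lambda,0)$, let $C=\{0\}\times[0,1]$, and let $F_C^\lambda$ be the unique non-empty compact set satisfying $F_C^\lambda=S_0(F_C^\lambda)\cup S_1(F_C^\lambda)\cup C$. Then the box dimension of $F_C^\lambda$ exists and \[ \dim_{\mathrm B} F_C^\lambda=\frac{\log(4\lambda)}{\log 2}>1. \]
   Context: A Garsia number is a positive real algebraic integer with norm $\pm2$ all of whose Galois conjugates have modulus strictly greater than $1$. For bounded $E\subseteq\mathbb{R}^n$ and $\delta>0$, $N_\delta(E)$ is the number of half-open cubes (products of half-open intervals $[a,b)$) of the $\delta$-mesh aligned with the coordinate axes that intersect $E$; the upper and lower box dimensions are $\limsup_{\delta\to0}$ and $\liminf_{\delta\to0}$ of $\log N_\delta(E)/(-\log\delta)$, and the box dimension $\dim_{\mathrm B}E$ is their common value when they agree. *)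

(* Defs.v *)
From HB Require Import structures.
From mathcomp Require Import all_boot all_order all_algebra.
From mathcomp Require Import all_classical all_reals all_analysis.
From mathcomp Require Import finmap complex.
Set Implicit Arguments. Unset Strict Implicit. Unset Printing Implicit Defensive.
Import Order.TTheory GRing.Theory Num.Theory.
Import numFieldNormedType.Exports.
Local Open Scope classical_set_scope.
Local Open Scope ring_scope.

(* A Garsia number: a positive real algebraic integer beta whose minimal
   polynomial p (monic, integer coefficients, irreducible over Q) has
   |p(0)| = 2 (i.e. norm +-2) and all of whose roots in C = R[i]
   (the Galois conjugates of beta) have modulus > 1. *)
Definition garsia (R : realType) (b : R) : Prop :=
  0 < b /\
  exists p : {poly int},
    [/\ p \is monic,
        irreducible_poly (map_poly (intr : int -> rat) p),
        root (map_poly (intr : int -> R) p) b,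
        `|p`_0| = 2 &
        forall z : complex.complex R,
          root (map_poly (intr : int -> complex.complex R) p) z -> 1 < `|z| ].

(* Index of the half-open delta-mesh square [i d,(i+1) d) x [j d,(j+1) d)
   containing x. *)
Definition mesh_index (R : realType) (d : R) (x : R * R) : int * int :=
  (Num.floor (x.1 / d), Num.floor (x.2 / d)).

(* N_delta(E): number of delta-mesh squares meeting E (E bounded, so finite). *)
Definition Ndelta (R : realType) (d : R) (E : set (R * R)) : nat :=
  #|` fset_set (mesh_index d @` E) |.

Definition box_ratio (R : realType) (E : set (R * R)) (d : R) : \bar R :=
  ((ln (Ndelta d E)%:R) / (- ln d))%:E.

Definition upper_box_dim (R : realType) (E : set (R * R)) : \bar R :=
  limf_esup (box_ratio E) (0 : R)^'+.

Definition lower_box_dim (R : realType) (E : set (R * R)) : \bar R :=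
  limf_einf (box_ratio E) (0 : R)^'+.

Definition box_dim_eq (R : realType) (E : set (R * R)) (s : R) : Prop :=
  upper_box_dim E = s%:E /\ lower_box_dim E = s%:E.

Definition unit_square (R : realType) : set (R * R) :=
  [set x | 0 <= x.1 <= 1 /\ 0 <= x.2 <= 1].

Definition S0 (R : realType) (l : R) (x : R * R) : R * R := (l * x.1, l * x.2).
Definition S1 (R : realType) (l : R) (x : R * R) : R * R :=
  (l * x.1 + (1 - l), l * x.2).

Definition condC (R : realType) : set (R * R) :=
  [set x | x.1 = 0 /\ 0 <= x.2 <= 1].

(* Main.v *)
Require Import Defs.
From HB Require Import structures.
From mathcomp Require Import all_boot all_order all_algebra.
From mathcomp Require Import all_classical all_reals all_analysis.
From mathcomp Require Import finmap complex lra ring zify.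
Import Order.TTheory GRing.Theory Num.Theory.
Import numFieldNormedType.Exports.
Local Open Scope classical_set_scope.
Local Open Scope ring_scope.

(* [F] contains, for each binary word of length [k], a vertical segment of
   height [l ^ k]. By Garsia's lemma the abscissas of these [2 ^ k] segments are
   [c / 2 ^ k]-separated: a difference of two of them is, up to normalisation,
   the value at [1 / l] of a nonzero integer polynomial with coefficients in
   [{-1, 0, 1}], and the product of this value over all conjugates of [1 / l] is
   a nonzero integer. At scale [d ~ 2 ^ -k] the level-[k] segments therefore
   meet about [2 ^ k * l ^ k / d ~ (4 l) ^ k] squares. Conversely the segments
   of level below [k] together with the strip [0, 1] x [0, l ^ k] cover [F] and
   meet at most a constant times [(4 l) ^ k] squares. *)

(** * Products over conjugates and Garsia's lemma *)

(** Both sides are multiplicative in [P], and a factor ['X - w] contributes [\det (A - w)], the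
    product of the [z - w]. *)
Lemma det_horner_mx (C : closedFieldType) (n : nat) (A : 'M[C]_n.+1)
    (s : seq C) (P : {poly C}) :
  char_poly A = \prod_(z <- s) ('X - z%:P) ->
  \det (horner_mx A P) = \prod_(z <- s) P.[z].
Proof.
move=> chA.
have sz_s : size s = n.+1.
  by apply: succn_inj; rewrite -(size_prod_XsubC s id) -chA size_char_poly.
have [r ->] := closed_field_poly_normal P.
have -> Q : horner_mx A (lead_coef P *: Q) = lead_coef P *: horner_mx A Q.
  exact: horner_mxZ.
rewrite detZ rmorph_prod /=.
under [RHS]eq_bigr do rewrite hornerZ horner_prod.
rewrite big_split /= big_const_seq count_predT iter_mulr_1 sz_s.
congr (_ * _); rewrite exchange_big /=.
rewrite (big_morph _ (@det_mulmx _ _) (det1 _ _)); apply: eq_bigr => w _.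
under [RHS]eq_bigr do rewrite hornerXsubC.
have -> : horner_mx A ('X - w%:P) = - 1 *: (w%:M - A).
  by rewrite rmorphB /= horner_mx_X horner_mx_C scaleN1r opprB.
have -> : \det (- 1 *: (w%:M - A)) = (-1) ^+ n.+1 * (char_poly A).[w].
  rewrite detZ; congr (_ * _).
  rewrite /char_poly -horner_evalE -det_map_mx; congr (\det _).
  apply/matrixP=> i j; rewrite !mxE /= /horner_eval.
  by rewrite hornerD hornerN hornerMn hornerX hornerC.
(* The sign [(-1) ^+ n.+1] is spread over the [n.+1] roots, turning each [w - z] into [z - w]. *)
rewrite chA horner_prod -sz_s -count_predT.
rewrite -(iter_mulr_1 _ (-1)) -big_const_seq -big_split /=.
by apply: eq_bigr => z _; rewrite hornerXsubC mulN1r opprB.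
Qed.

(** For [A] the companion matrix of [p], the product is the determinant of [P] evaluated at [A], an
    integer matrix. *)
Lemma prod_horner_roots_int (C : closedFieldType) (p P : {poly int}) (s : seq C) :
  p \is monic -> (1 < size p)%N ->
  map_poly intr p = \prod_(z <- s) ('X - z%:P) ->
  exists m : int, \prod_(z <- s) (map_poly intr P).[z] = m%:~R.
Proof.
move=> p_monic sz_p ps.
have [d [A chA]] : exists d (A : 'M[int]_d), char_poly A = p.
  by exists (size p).-1, (companionmx p); exact: companionmxK.
case: d A chA => [|d] A chA.
  by move: sz_p; rewrite -chA size_char_poly.
exists (\det (horner_mx A P)).
rewrite -[in RHS]/(intmul 1 _) -det_map_mx map_horner_mx.
rewrite (@det_horner_mx _ _ _ s) //.
by rewrite -map_char_poly chA.
Qed.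

(** The lowest nonzero coefficient of [q * p] is the constant term of [p] times that of [q], hence
    of modulus at least [2]. *)
Lemma monic_ndvd_height1 (p P : {poly int}) :
  p \is monic -> `|p`_0| = 2 -> P != 0 -> (forall i, `|P`_i| <= 1) ->
  ~~ (p %| P).
Proof.
move=> p_monic p0 Pn0 hP; apply/negP => /(Pdiv.IdomainMonic.dvdpP p_monic)[q Pq].
suff q0 : q = 0 by move: Pn0; rewrite Pq q0 mul0r eqxx.
apply/polyP => n; rewrite coef0; elim/ltn_ind: n => n IH.
have : P`_n = p`_0 * q`_n.
  rewrite Pq coefM big_ord_recr /= subnn big1 ?add0r 1?mulrC // => i _.
  by rewrite IH // mul0r.
by move: (hP n) p0; lia.
Qed.

(** Being irreducible, [p] is coprime over the rationals to any polynomial it does not divide;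
    coprimality survives the passage to [C] and excludes common roots. *)
Lemma horner_conjugate_neq0 (C : numFieldType) (p P : {poly int}) (z : C) :
  p \is monic -> irreducible_poly (map_poly (intr : int -> rat) p) ->
  `|p`_0| = 2 -> P != 0 -> (forall i, `|P`_i| <= 1) ->
  root (map_poly intr p) z -> (map_poly intr P).[z] != 0.
Proof.
move=> p_monic p_irr p0 Pn0 hP.
apply: coprimep_root.
have mapE Q : map_poly (intr : int -> C) Q = map_poly ratr (map_poly intr Q).
  by rewrite -map_poly_comp; apply: eq_map_poly => x /=; rewrite ratr_int.
rewrite !mapE coprimep_map irreducible_poly_coprime // dvdp_rat_int.
exact: monic_ndvd_height1.
Qed.

(** Comparison with the geometric series in [|z|], its denominator cleared. *)
Lemma norm_horner_height1 (C : numDomainType) (P : {poly int}) (k : nat) (z : C) :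
  (size P <= k)%N -> (forall i, `|P`_i| <= 1) -> 1 < `|z| ->
  `|(map_poly intr P).[z]| * (`|z| - 1) <= `|z| ^+ k.
Proof.
move=> szP hP z1.
apply: (@le_trans _ _ (`|z| ^+ k - 1)); last by rewrite gerBl.
rewrite subrX1 mulrC ler_wpM2l ?subr_ge0 ?(ltW z1) //.
rewrite (@horner_coef_wide _ k); last exact: leq_trans (size_poly _ _) szP.
apply: (le_trans (ler_norm_sum _ _ _)); apply: ler_sum => i _.
rewrite coef_map /= normrM normrX ler_piMl ?exprn_ge0 //.
by rewrite -intr_norm -[1]/(1%:~R) ler_int.
Qed.

(* The product of [P] over all conjugates is a nonzero integer; bounding the
   factors at the conjugates other than [b] uses that their product has modulus
   [2 / |b|]. *)
Lemma garsia_horner_lower_bound (C : numClosedFieldType) (p : {poly int}) (b : C) :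
  p \is monic -> irreducible_poly (map_poly (intr : int -> rat) p) ->
  `|p`_0| = 2 -> root (map_poly intr p) b ->
  (forall z : C, root (map_poly intr p) z -> 1 < `|z|) ->
  exists2 D : C, 0 < D &
    forall (P : {poly int}) (k : nat), P != 0 -> (size P <= k)%N ->
      (forall i, `|P`_i| <= 1) ->
      D * `|b| ^+ k <= `|(map_poly intr P).[b]| * 2 ^+ k.
Proof.
move=> p_monic p_irr p0 pb hz.
have sz_p : (1 < size p)%N.
  case: p_irr => + _; rewrite size_map_poly_id0 //.
  by rewrite (monicP p_monic) oner_eq0.
have [s0 ps0] := closed_field_poly_normal (map_poly (intr : int -> C) p).
have pCm : map_poly (intr : int -> C) p \is monic by rewrite monic_map.
rewrite (monicP pCm) scale1r in ps0.
have bs0 : b \in s0 by move: pb; rewrite ps0 root_prod_XsubC.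
pose s := rem b s0.
have bigs0 (F : C -> C) : \prod_(z <- s0) F z = F b * \prod_(z <- s) F z.
  by rewrite (perm_big _ (perm_to_rem bs0)) big_cons.
have s_gt1 z : z \in s -> 1 < `|z|.
  by move=> zs; apply: hz; rewrite ps0 root_prod_XsubC; exact: mem_rem zs.
have prod_s : `|b| * \prod_(z <- s) `|z| = 2.
  rewrite -(bigs0 Num.norm) -(big_morph _ (@normrM C) (normr1 C)).
  have <- : `|(map_poly (intr : int -> C) p).[0]| = 2.
    by rewrite horner_coef0 coef_map /= -intr_norm p0.
  rewrite ps0 horner_prod !(big_morph _ (@normrM C) (normr1 C)).
  by apply: eq_bigr => z _; rewrite hornerXsubC sub0r normrN.
exists (\prod_(z <- s) (`|z| - 1)).
  rewrite big_seq; by apply: prodr_gt0 => z /s_gt1; rewrite subr_gt0.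
move=> P k Pn0 szP hP.
have [m mE] := @prod_horner_roots_int C p P s0 p_monic sz_p ps0.
have m1 : 1 <= `|m%:~R : C|.
  suff mn0 : m%:~R != 0 :> C.
    rewrite -intr_norm -[1]/(1%:~R) ler_int.
    by move: mn0; rewrite intr_eq0; lia.
  rewrite -mE prodf_seq_neq0; apply/allP => z zs /=.
  by apply: horner_conjugate_neq0 p_irr _ _ _ _ => //; rewrite ps0 root_prod_XsubC.
rewrite -mE bigs0 normrM (big_morph _ (@normrM C) (normr1 C)) in m1.
have prod_le : \prod_(z <- s) (`|(map_poly intr P).[z]| * (`|z| - 1))
    <= (\prod_(z <- s) `|z|) ^+ k.
  rewrite -prodrXl big_seq [leRHS]big_seq; apply: ler_prod => z /s_gt1 z1.
  by rewrite norm_horner_height1 // andbT mulr_ge0 // subr_ge0 ltW.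
rewrite big_split /= in prod_le.
(* Writing [2] as the product of the moduli of all roots lets [|b| ^+ k] cancel. *)
rewrite -prod_s exprMn.
have D0 : 0 <= \prod_(z <- s) (`|z| - 1).
  by rewrite big_seq; apply: prodr_ge0 => z /s_gt1; rewrite subr_ge0 => /ltW.
rewrite [X in _ <= X]mulrCA [X in X <= _]mulrC ler_wpM2l ?exprn_ge0 //.
apply: le_trans (_ : _ <= `|(map_poly intr P).[b]| *
  (\prod_(z <- s) `|(map_poly intr P).[z]| * \prod_(z <- s) (`|z| - 1))) _.
  by rewrite mulrA ler_peMl.
by rewrite ler_wpM2l.
Qed.

(** * Words as digit expansions, and separation of abscissas *)

(** The word is read in base [l^-1] with its head as most significant digit, since the translation
    of the map applied last is not contracted further. *)
Fixpoint word_poly (w : seq bool) : {poly int} :=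
  if w is b :: w' then b%:R *: 'X^(size w') + word_poly w' else 0.

(* [word_pos l w] is the abscissa of the segment [S_w(C)], the head of [w]
   being the map applied last. *)
Fixpoint word_pos {R : pzRingType} (l : R) (w : seq bool) : R :=
  if w is b :: w' then l * word_pos l w' + (1 - l) * b%:R else 0.

Lemma coef_word_poly (w : seq bool) (i : nat) :
  (word_poly w)`_i = (nth false (rev w) i)%:R.
Proof.
elim: w => [|b w IH] /=; first by rewrite coef0 nth_nil.
rewrite coefD coefZ coefXn IH rev_cons nth_rcons size_rev.
case: ltngtP => [iw|iw|->]; last 1 first.
- by rewrite mulr1 nth_default ?addr0 ?size_rev.
- by rewrite mulr0 add0r.
- by rewrite mulr0 add0r nth_default // size_rev ltnW.
Qed.

Lemma size_word_poly (w : seq bool) : (size (word_poly w) <= size w)%N.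
Proof.
apply/leq_sizeP => i wi.
by rewrite coef_word_poly nth_default // size_rev.
Qed.

Lemma word_poly_inj (w w' : seq bool) :
  size w = size w' -> word_poly w = word_poly w' -> w = w'.
Proof.
move=> sz eqp; apply: (can_inj revK).
apply: (@eq_from_nth _ false) => [|i _]; first by rewrite !size_rev.
have := congr1 (fun p : {poly int} => p`_i) eqp; rewrite /= !coef_word_poly.
by case: nth; case: nth.
Qed.

(** The factor [l ^+ size w] clears the powers of [l^-1], of which the largest possible is
    [size w - 1]; hence the spare [l] on the right. *)
Lemma horner_word_poly (F : fieldType) (l : F) (w : seq bool) : l != 0 ->
  (map_poly intr (word_poly w)).[l^-1] * ((1 - l) * l ^+ size w) = l * word_pos l w.
Proof.
move=> l0; elim: w => [|b w IH] /=; first by rewrite rmorph0 horner0 mul0r mulr0.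
have -> : map_poly intr (b%:R *: 'X^(size w) + word_poly w) =
    b%:R *: 'X^(size w) + map_poly (intr : int -> F) (word_poly w).
  by rewrite rmorphD /= map_polyZ map_polyXn /= rmorph_nat.
rewrite hornerD hornerZ hornerXn mulrDl exprS.
rewrite [X in _ + X](_ : _ = l * (l * word_pos l w)); last by rewrite -IH; ring.
have lK : l^-1 ^+ size w * l ^+ size w = 1 by rewrite -exprMn mulVf // expr1n.
rewrite [X in X + _](_ : _ = b%:R * (1 - l) * l * (l^-1 ^+ size w * l ^+ size w)).
  by rewrite lK; ring.
by ring.
Qed.

Lemma normc_real (R : rcfType) (x : R) : `|x%:C%C| = `|x|%:C%C.
Proof. by rewrite normc_def /= expr0n addr0 sqrtr_sqr. Qed.

(** The polynomial bound at [l^-1] is [D * (2 * l) ^- k]; rescaling to abscissas multiplies it by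
    [(1 - l) * l ^+ k / l], which leaves [2 ^- k] times a constant. *)
Lemma word_pos_separation (R : realType) (l : R) :
  0 < l -> l < 1 -> garsia l^-1 ->
  exists2 c : R, 0 < c & forall w w' : seq bool, size w = size w' -> w != w' ->
    c <= `|word_pos l w - word_pos l w'| * 2 ^+ size w.
Proof.
move=> l0 l1 [_ [p [p_monic p_irr pb p0 hz]]].
have mapC Q : map_poly (intr : int -> R[i]) Q =
    map_poly (real_complex R) (map_poly intr Q).
  by rewrite -map_poly_comp; apply: eq_map_poly => x /=; rewrite rmorph_int.
have pbC : root (map_poly intr p) (l^-1)%:C%C.
  by rewrite mapC; exact: rmorph_root pb.
have [D D0 hD] := @garsia_horner_lower_bound R[i] p _ p_monic p_irr p0 pbC hz.
(* Positivity in [R[i]] includes being real. *)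
have DE : D = (complex.Re D)%:C%C by rewrite RRe_real // realE ltW.
rewrite DE (ltcR 0) in D0.
exists ((1 - l) * complex.Re D / l); first by rewrite !mulr_gt0 ?subr_gt0 ?invr_gt0.
move=> w w' sz ww'; set k := size w.
pose P := word_poly w - word_poly w'.
have : complex.Re D * l^-1 ^+ k <= `|(map_poly intr P).[l^-1]| * 2 ^+ k.
  have : D * `|(l^-1)%:C%C| ^+ k
      <= `|(map_poly (intr : int -> R[i]) P).[(l^-1)%:C%C]| * 2 ^+ k.
    apply: hD.
    - rewrite subr_eq0; apply: contraNneq ww' => /word_poly_inj ->//.
    - rewrite (leq_trans (size_polyD _ _)) // size_polyN geq_max size_word_poly /=.
      by rewrite /k sz size_word_poly.
    - move=> i; rewrite coefB !coef_word_poly.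
      by case: nth; case: nth.
  rewrite {1}DE mapC horner_map /= !normc_real.
  have -> : (2 : R[i]) = 2%:C%C by rewrite rmorph_nat.
  rewrite -!rmorphXn -!rmorphM lecR.
  by rewrite (@gtr0_norm _ l^-1) ?invr_gt0.
have PE : l * (word_pos l w - word_pos l w') =
    (map_poly intr P).[l^-1] * ((1 - l) * l ^+ k).
  rewrite rmorphB hornerD hornerN mulrBl horner_word_poly ?gt_eqF //.
  by rewrite /k sz horner_word_poly ?gt_eqF // mulrBr.
have dE : `|word_pos l w - word_pos l w'| =
    `|(map_poly intr P).[l^-1]| * ((1 - l) * l ^+ k) / l.
  apply: (mulfI (x := l)); first by rewrite gt_eqF.
  rewrite mulrCA divff ?gt_eqF // mulr1 -{1}(gtr0_norm l0) -normrM PE normrM.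
  by rewrite [X in _ * X]gtr0_norm // mulr_gt0 ?exprn_gt0 ?subr_gt0.
rewrite dE => h.
have lk : 0 < (1 - l) * l ^+ k / l.
  by rewrite !mulr_gt0 ?invr_gt0 ?exprn_gt0 ?subr_gt0.
have := ler_wpM2l (ltW lk) h.
have lK : l ^+ k * l^-1 ^+ k = 1 by rewrite -exprMn divff ?gt_eqF // expr1n.
have -> : (1 - l) * l ^+ k / l * (complex.Re D * l^-1 ^+ k) =
  (1 - l) * complex.Re D / l * (l ^+ k * l^-1 ^+ k) by ring.
rewrite lK mulr1 => /le_trans; apply.
by rewrite le_eqVlt; apply/predU1P; left; ring.
Qed.

(** * Segments inside the attractor and a cover of it *)

Lemma segment_sub (R : realType) (l : R) (F : set (R * R)) (w : seq bool) (y : R) :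
  0 < l -> F = S0 l @` F `|` S1 l @` F `|` @condC R ->
  0 <= y <= l ^+ size w -> F (word_pos l w, y).
Proof.
move=> l0 FE; elim: w y => [|b w IH] y /= hy; rewrite FE; first by right.
left; have hy' : 0 <= y / l <= l ^+ size w.
  case/andP: hy => y0 y1; rewrite divr_ge0 ?(ltW l0) //=.
  by rewrite ler_pdivrMr // -exprSr.
have yE : l * (y / l) = y by rewrite mulrCA divff ?gt_eqF // mulr1.
by case: b; [right|left]; exists (word_pos l w, y / l);
  rewrite /S0 /S1 /= ?yE ?mulr1 ?mulr0 ?addr0 //; exact: IH.
Qed.

(** Unfolding the equation, either the descent stops in [C] after fewer than [k] maps, or [k] maps
    act on a point of the unit square and shrink its height to at most [l ^+ k]. *)
Lemma attractor_cover (R : realType) (l : R) (F : set (R * R)) (k : nat) (z : R * R) :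
  0 < l -> F `<=` @unit_square R -> F = S0 l @` F `|` S1 l @` F `|` @condC R ->
  F z -> (exists2 w, (size w < k)%N & z.1 = word_pos l w /\ 0 <= z.2 <= l ^+ size w) \/
    0 <= z.2 <= l ^+ k.
Proof.
move=> l0 Fsq FE; elim: k z => [|k IH] z Fz.
  by right; have [_] := Fsq _ Fz.
have lift (b : bool) z' : F z' -> z.1 = l * z'.1 + (1 - l) * b%:R -> z.2 = l * z'.2 ->
    (exists2 w, (size w < k.+1)%N & z.1 = word_pos l w /\ 0 <= z.2 <= l ^+ size w) \/
    0 <= z.2 <= l ^+ k.+1.
  move=> /IH[[w wk [z1 z2]]|z2] -> ->.
    left; exists (b :: w) => //=; rewrite z1; split=> //.
    by case/andP: z2 => ? ?; rewrite mulr_ge0 ?(ltW l0) //= exprS ler_wpM2l // ltW.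
  by right; case/andP: z2 => ? ?; rewrite mulr_ge0 ?(ltW l0) //= exprS ler_wpM2l // ltW.
move: (Fz); rewrite {1}FE => -[[[z' Fz' zE]|[z' Fz' zE]]|[z1 z2]].
- by apply: (lift false z' Fz'); rewrite -zE /S0 /= ?mulr0 ?addr0.
- by apply: (lift true z' Fz'); rewrite -zE /S1 /= ?mulr1.
- by left; exists [::].
Qed.

(** * Counting mesh squares *)

(** Rows start at [0] because every segment stands on the horizontal axis. *)
Definition column (R : realType) (d : R) (i : int) (h : R) : seq (int * int) :=
  [seq (i, Posz j) | j <- iota 0 (Num.truncn (h / d)).+1].

Lemma floor_ge0_mem (R : realType) (d h y : R) : 0 < d -> 0 <= y <= h ->
  exists2 j, j \in iota 0 (Num.truncn (h / d)).+1 & Num.floor (y / d) = Posz j.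
Proof.
move=> d0 /andP[y0 yh]; exists (Num.truncn (y / d)).
  by rewrite mem_iota /= add0n ltnS; apply: le_truncn; rewrite ler_pM2r ?invr_gt0.
have yd0 : 0 <= y / d by rewrite divr_ge0 // ltW.
by rewrite truncn_floor yd0 gez0_abs // floor_ge0.
Qed.

Lemma mem_column (R : realType) (d h : R) (z : R * R) : 0 < d -> 0 <= z.2 <= h ->
  mesh_index d z \in column R d (Num.floor (z.1 / d)) h.
Proof.
move=> d0 /(floor_ge0_mem R d h _ d0)[j jh jE].
by rewrite /mesh_index jE; apply: map_f.
Qed.

Lemma size_column_le (R : realType) (d h : R) (i : int) : 0 < d -> 0 <= h ->
  (size (column R d i h))%:R <= h / d + 1.
Proof.
move=> d0 h0; rewrite size_map size_iota -natr1 lerD2r truncn_le.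
by rewrite divr_ge0 // ltW.
Qed.

Definition words (k : nat) : seq (seq bool) := [seq val t | t <- enum {: k.-tuple bool}].

Lemma mem_words (w : seq bool) : w \in words (size w).
Proof. by apply/mapP; exists (in_tuple w); rewrite ?mem_enum. Qed.

Lemma size_mem_words (k : nat) (w : seq bool) : w \in words k -> size w = k.
Proof. by case/mapP => t _ ->; rewrite size_tuple. Qed.

Lemma size_words (k : nat) : size (words k) = (2 ^ k)%N.
Proof. by rewrite size_map -cardE card_tuple card_bool. Qed.

Lemma uniq_words (k : nat) : uniq (words k).
Proof. by rewrite map_inj_uniq ?enum_uniq //; exact: val_inj. Qed.

Lemma segments_mesh_cover (R : realType) (l d : R) (k : nat) : 0 < l -> 0 < d ->
  exists2 s : seq (int * int),
    (size s)%:R <= \sum_(m < k) 2 ^+ m * (l ^+ m / d + 1) &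
    forall (w : seq bool) (z : R * R), (size w < k)%N -> z.1 = word_pos l w ->
      0 <= z.2 <= l ^+ size w -> mesh_index d z \in s.
Proof.
move=> l0 d0; elim: k => [|k [s sz_s hs]].
  by exists [::]; rewrite ?big_ord0.
pose t := flatten [seq column R d (Num.floor (word_pos l w / d)) (l ^+ k) | w <- words k].
exists (s ++ t).
  rewrite big_ord_recr size_cat natrD /= lerD //.
  rewrite size_flatten /shape -map_comp sumnE big_map natr_sum.
  rewrite -natrX -size_words mulr_natl.
  have -> : (l ^+ k / d + 1) *+ size (words k) = \sum_(w <- words k) (l ^+ k / d + 1).
    by rewrite big_const_seq count_predT iter_addr_0.
  apply: ler_sum => w _.
  by apply: size_column_le => //; rewrite exprn_ge0 // ltW.
move=> w z; rewrite ltnS leq_eqVlt mem_cat => /orP[/eqP wk|wk] z1 z2; last first.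
  by rewrite (hs w).
apply/orP; right; apply/flattenP.
exists (column R d (Num.floor (word_pos l w / d)) (l ^+ k)).
  by apply/mapP; exists w; rewrite // -wk mem_words.
by rewrite -z1; apply: mem_column; rewrite // -wk.
Qed.

(** The last term counts the squares of the strip of width [1] and height [l ^+ k], which holds the
    points on no segment of level below [k]. *)
Lemma attractor_mesh_cover (R : realType) (l d : R) (F : set (R * R)) (k : nat) :
  0 < l -> 0 < d ->
  F `<=` @unit_square R -> F = S0 l @` F `|` S1 l @` F `|` @condC R ->
  exists2 s : seq (int * int),
    (size s)%:R <=
      \sum_(m < k) 2 ^+ m * (l ^+ m / d + 1) + (1 / d + 1) * (l ^+ k / d + 1) &
    mesh_index d @` F `<=` [set` s].
Proof.
move=> l0 d0 Fsq FE; have [s sz_s hs] := segments_mesh_cover R l d k l0 d0.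
pose t := [seq (Posz i, Posz j) | i <- iota 0 (Num.truncn (1 / d)).+1,
                                  j <- iota 0 (Num.truncn (l ^+ k / d)).+1].
exists (s ++ t).
  rewrite size_cat natrD lerD // size_allpairs !size_iota natrM.
  by rewrite ler_pM // -natr1 lerD2r truncn_le divr_ge0 ?exprn_ge0 ?ltW.
move=> _ [z Fz <-] /=; rewrite mem_cat.
case: (attractor_cover R l F k z l0 Fsq FE Fz) => [[w wk [z1 z2]]|z2].
  by rewrite (hs w z).
have [z1 _] := Fsq _ Fz.
have [i id iE] := floor_ge0_mem R d 1 _ d0 z1.
have [j jd jE] := floor_ge0_mem R d (l ^+ k) _ d0 z2.
by rewrite /mesh_index iE jE; apply/orP; right; 
  exact: (allpairs_f (fun i j => (Posz i, Posz j))).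
Qed.

Lemma Ndelta_le_size (R : realType) (d : R) (E : set (R * R)) (s : seq (int * int)) :
  mesh_index d @` E `<=` [set` s] -> (Ndelta d E <= size s)%N.
Proof.
move=> Es; have fin : finite_set (mesh_index d @` E).
  exact: sub_finite_set Es (finite_seq s).
apply: uniq_leq_size; first exact: fset_uniq.
by move=> x; rewrite in_fset_set // => /set_mem/Es.
Qed.

(** Finiteness matters here: [fset_set] is empty by default on an infinite set. *)
Lemma Ndelta_ge_size (R : realType) (d : R) (E : set (R * R)) (s : seq (int * int)) :
  finite_set (mesh_index d @` E) -> uniq s -> {in s, forall i, (mesh_index d @` E) i} ->
  (size s <= Ndelta d E)%N.
Proof.
move=> fin us sE; apply: uniq_leq_size => // x /sE xE.
rewrite in_fset_set //; exact: mem_set.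
Qed.

(** Since [2 * l > 1], the geometric sum over levels is governed by its last term; as [d] is
    comparable to [2 ^- k], the strip has the same order [(2 * l) ^+ k / d]. *)
Lemma Ndelta_attractor_upper (R : realType) (l d : R) (F : set (R * R)) (k : nat) :
  2^-1 < l -> l < 1 -> 0 < d ->
  F `<=` @unit_square R -> F = S0 l @` F `|` S1 l @` F `|` @condC R ->
  2 ^+ k <= d^-1 < 2 ^+ k.+1 ->
  (Ndelta d F)%:R <= ((2 * l - 1)^-1 + 7) * d^-1 * (2 * l) ^+ k.
Proof.
move=> l2 l1 d0 Fsq FE /andP[kd dk].
have l0 : 0 < l by apply: lt_trans l2; rewrite invr_gt0.
have [s sz_s Fs] := attractor_mesh_cover R l d F k l0 d0 Fsq FE.
apply: (@le_trans _ _ (size s)%:R); first by rewrite ler_nat Ndelta_le_size.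
apply: (le_trans sz_s); rewrite div1r.
set D := d^-1 in kd dk *; have D0 : 0 < D by rewrite invr_gt0.
set q := 2 * l; have q1 : 1 < q by rewrite /q; lra.
have q0 : 0 < q - 1 by rewrite subr_gt0.
have qk : 1 <= q ^+ k by rewrite exprn_ege1 // ltW.
have p2 : 1 <= 2 ^+ k :> R by rewrite exprn_ege1 // ler1n.
have sum1 : \sum_(m < k) 2 ^+ m * (l ^+ m * D + 1)
    <= (q - 1)^-1 * D * q ^+ k + D * q ^+ k.
  under eq_bigr do rewrite mulrDr mulr1 mulrA -exprMn.
  rewrite big_split /= -mulr_suml; apply: lerD.
    rewrite -mulrA [X in _ <= X]mulrC -mulrA [X in _ <= X]mulrC ler_wpM2r ?(ltW D0) //.
    rewrite ler_pdivlMr // mulrC -/q -subrX1; lra.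
  (* The summands [2 ^+ m] add up to [2 ^+ k - 1], which is below [D]. *)
  have := subrX1 (2 : R) k; rewrite (_ : 2 - 1 = 1 :> R) ?mul1r; last by lra.
  move=> <-; nra.
have lk : l ^+ k * D <= 2 * q ^+ k.
  rewrite /q exprMn mulrA -exprS mulrC ler_wpM2r ?exprn_ge0 ?ltW //.
have D1 : 1 <= D by lra.
(* Here [6 = 2 * 3]; with the second term of [sum1] this makes the constant [7]. *)
have sum2 : (D + 1) * (l ^+ k * D + 1) <= 6 * D * q ^+ k.
  apply: (@le_trans _ _ ((2 * D) * (3 * q ^+ k))); last first.
    by rewrite le_eqVlt; apply/predU1P; left; ring.
  have ? : 0 <= l ^+ k * D by rewrite mulr_ge0 ?exprn_ge0 ?ltW.
  by apply: ler_pM; lra.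
apply: (le_trans (lerD sum1 sum2)).
by rewrite le_eqVlt; apply/predU1P; left; ring.
Qed.

(** The condition on [k] makes the separation at least [d], so distinct words of length [k] occupy
    distinct columns, and in each the segment meets more than [l ^+ k / d] squares. *)
Lemma Ndelta_attractor_lower (R : realType) (l d c : R) (F : set (R * R)) (k : nat) :
  0 < l -> 0 < d ->
  F `<=` @unit_square R -> F = S0 l @` F `|` S1 l @` F `|` @condC R ->
  (forall w w' : seq bool, size w = size w' -> w != w' ->
     c <= `|word_pos l w - word_pos l w'| * 2 ^+ size w) ->
  2 ^+ k <= c * d^-1 ->
  d^-1 * (2 * l) ^+ k <= (Ndelta d F)%:R.
Proof.
move=> l0 d0 Fsq FE sep kd.
(* Level [0] covers by the unit square alone, enough for finiteness. *)
have [s _ Fs] := attractor_mesh_cover R l d F 0 l0 d0 Fsq FE.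
have fin : finite_set (mesh_index d @` F) by exact: sub_finite_set Fs (finite_seq s).
set n := (Num.truncn (l ^+ k / d)).+1.
have lk0 : 0 <= l ^+ k / d by rewrite divr_ge0 ?exprn_ge0 ?ltW.
pose t := [seq (Num.floor (word_pos l w / d), Posz j) | w <- words k, j <- iota 0 n].
apply: (@le_trans _ _ (size t)%:R).
  rewrite size_allpairs size_iota size_words natrM natrX exprMn mulrCA.
  by rewrite ler_wpM2l ?exprn_ge0 // mulrC ltW // truncnS_gt.
rewrite ler_nat; apply: Ndelta_ge_size => //.
  apply: allpairs_uniq; rewrite ?uniq_words ?iota_uniq //.
  move=> u v hu hv; case/allpairsP: hu => -[w i] /= [wk _ ->].
  case/allpairsP: hv => -[w' j] /= [w'k _ ->].
  case=> fl ->; congr pair; apply/eqP; apply: contraT => ww'.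
  have := sep _ _ (etrans (size_mem_words _ _ wk) (esym (size_mem_words _ _ w'k))) ww'.
  rewrite (size_mem_words _ _ wk).
  have : `|word_pos l w - word_pos l w'| < d.
    rewrite -[X in _ < X]mul1r -ltr_pdivrMr // -(gtr0_norm d0) -normf_div mulrBl.
    have := floor_itv (word_pos l w / d); have := floor_itv (word_pos l w' / d).
    by rewrite -fl intrD ltr_norml; lra.
  move: kd; rewrite mulrC ler_pdivlMl //.
  have : 0 < 2 ^+ k :> R by rewrite exprn_gt0.
  nra.
move=> i /allpairsP[[w j] [wk jn ->]]; move: jn; rewrite mem_iota add0n ltnS => jn.
(* This point lies on the bottom edge, which belongs to the half-open square. *)
exists (word_pos l w, j%:R * d).
  apply: segment_sub => //; rewrite (size_mem_words _ _ wk).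
  rewrite mulr_ge0 ?(ltW d0) //= -ler_pdivlMr //.
  by rewrite -truncn_ge_nat.
by rewrite /mesh_index /= mulfK ?gt_eqF // -[j%:R]/(j%:~R) intrKfloor.
Qed.

(** * From logarithmic estimates to the box dimension *)

(** The band around [s] belongs to [G], which bounds the infimum of suprema above; every member of
    [G] meets the band by properness, which bounds it below. *)
Lemma limf_esup_squeeze (T : choiceType) (X : filteredType T) (R : realType)
    (f : X -> \bar R) (G : set (set X)) (s : R) : ProperFilter G ->
  (forall e : R, 0 < e -> G [set x | ((s - e)%:E <= f x <= (s + e)%:E)%E]) ->
  limf_esup f G = s%:E.
Proof.
move=> PG hf; rewrite limf_esupE; apply/eqP; rewrite eq_le; apply/andP; split.
  apply/lee_addgt0Pr => e e0.
  apply: le_trans (_ : _ <= ereal_sup [set f x | x in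
    [set x | ((s - e)%:E <= f x <= (s + e)%:E)%E]])%E _.
    apply: ereal_inf_lbound.
    by exists [set x | ((s - e)%:E <= f x <= (s + e)%:E)%E] => //; exact: hf.
  by apply: ge_ereal_sup => _ [x /andP[_ ?] <-].
apply: le_ereal_inf_tmp => _ [V GV <-].
apply/lee_subgt0Pr => e e0.
have [x [Vx /andP[fx _]]] := filter_ex (filterI GV (hf e e0)).
by apply: le_trans fx _; apply: ereal_sup_ubound; exists x.
Qed.

(** A bounded error vanishes on division by [- ln d], which tends to infinity. *)
Lemma box_dim_eq_ln_bounded (R : realType) (E : set (R * R)) (s M : R) :
  (\forall d \near 0^'+, `|ln (Ndelta d E)%:R + s * ln d| <= M) ->
  box_dim_eq E s.
Proof.
move=> hM.
have ratio e : 0 < e -> \forall d \near (0:R)^'+,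
    ((s - e)%:E <= box_ratio E d <= (s + e)%:E)%E.
  move=> e0; near=> d.
  have d0 : 0 < d by near: d; exact: nbhs_right_gt.
  have L0 : 0 < - ln d.
    by rewrite oppr_gt0 ln_lt0 // d0; near: d; exact: nbhs_right_lt.
  have LM : M <= e * - ln d.
    rewrite mulrC -ler_pdivrMr // lerNr -ler_expR lnK ?posrE //.
    by near: d; apply: nbhs_right_ltW; rewrite expR_gt0.
  have : `|ln (Ndelta d E)%:R + s * ln d| <= M by near: d.
  rewrite /box_ratio !lee_fin ler_pdivlMr // ler_pdivrMr // ler_norml.
  by lra.
split; first exact: limf_esup_squeeze.
(* The lower limit is minus the upper limit of the negated ratio, squeezed at [- s]. *)
rewrite -[lower_box_dim E]oppeK -limf_esupN (limf_esup_squeeze _ _ _ _ _ (- s)).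
  by rewrite -EFinN opprK.
move=> e e0; apply: filterS (ratio e e0) => d /=.
by rewrite /box_ratio !lee_fin; move: (_ / _) => x; lra.
Unshelve. all: by end_near.
Qed.

(** Powers of two are integers, so [x] may be replaced by its integer part. *)
Lemma dyadic_scale (R : realType) (x : R) : 1 <= x ->
  exists k : nat, 2 ^+ k <= x < 2 ^+ k.+1.
Proof.
move=> x1; have x0 : 0 <= x by lra.
have t0 : (0 < Num.truncn x)%N by rewrite truncn_gt0.
have /andP[h1 h2] := trunc_log_bounds (ltnSn 1) t0.
exists (trunc_log 2 (Num.truncn x)).
by rewrite -!natrX -truncn_ge_nat // -truncn_lt_nat // h1.
Qed.

Theorem theorem2p1 (R : realType) (l : R) (F : set (R * R)) :
  2^-1 < l -> l < 1 -> garsia l^-1 ->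
  F !=set0 -> compact F -> F `<=` @unit_square R ->
  F = S0 l @` F `|` S1 l @` F `|` @condC R ->
  box_dim_eq F (ln (4 * l) / ln 2) /\ 1 < ln (4 * l) / ln 2.
Proof.
move=> l2 l1 lG _ _ Fsq FE.
have l0 : 0 < l by apply: lt_trans l2; rewrite invr_gt0.
have ln2 : 0 < ln 2 :> R by rewrite ln_gt0 // ltr1n.
set a := ln (2 * l); have a0 : 0 < a by rewrite ln_gt0 //; lra.
(* This form matches counts of order [d^-1 * (2 * l) ^+ k], and shows that the value exceeds [1]
   because [2 * l > 1]. *)
have sE : ln (4 * l) / ln 2 = 1 + a / ln 2.
  rewrite (_ : 4 * l = 2 * (2 * l)); last by ring.
  by rewrite lnM ?posrE ?mulr_gt0 // mulrDl divff // gt_eqF.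
have al2 : 0 < a / ln 2 by rewrite divr_gt0.
rewrite sE; split; last by lra.
have [c c0 sep] := word_pos_separation R l l0 l1 lG.
set A : R := (2 * l - 1)^-1 + 7.
have A0 : 0 < A by rewrite addr_gt0 // invr_gt0; lra.
(* Multiplying [(k + 1) * ln 2 >= ln c + L] by [a / ln 2], where [L = - ln d], gives
   [k * a >= a / ln 2 * L + B]. *)
set B := a / ln 2 * ln c - a.
apply: (@box_dim_eq_ln_bounded _ _ _ (`|ln A| + `|B|)).
near=> d.
have d0 : 0 < d by near: d; exact: nbhs_right_gt.
have d1 : d <= 1 by near: d; exact: nbhs_right_ltW.
(* This gives [1 <= c / d], so that a dyadic [k] exists for the lower bound. *)
have dc : d <= c by near: d; exact: nbhs_right_ltW.
set L := - ln d; have LE : ln d^-1 = L by rewrite lnV ?posrE.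
have lnq k : ln ((2 * l) ^+ k) = k%:R * a by rewrite lnXn ?mulr_gt0 // [RHS]mulr_natl.
have ln2k k : ln (2 ^+ k) = k%:R * ln 2 :> R by rewrite lnXn // [RHS]mulr_natl.
have qk k : 0 < (2 * l) ^+ k by rewrite exprn_gt0 ?mulr_gt0.
have lower : 0 < (Ndelta d F)%:R :> R /\ L + a / ln 2 * L + B <= ln (Ndelta d F)%:R.
  have [k /andP[kc ck]] : exists k : nat, 2 ^+ k <= c * d^-1 < 2 ^+ k.+1.
    by apply: dyadic_scale; rewrite ler_pdivlMr ?mul1r.
  have := Ndelta_attractor_lower R l d c F k l0 d0 Fsq FE sep kc.
  set N := (Ndelta d F)%:R => hN.
  have N0 : 0 < N by apply: lt_le_trans hN; rewrite mulr_gt0 ?invr_gt0.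
  split=> //; move: hN.
  rewrite -ler_ln ?posrE ?mulr_gt0 ?invr_gt0 // lnM ?posrE ?invr_gt0 // LE lnq.
  apply: le_trans; rewrite -addrA lerD2l.
  move: ck; rewrite -ltr_ln ?posrE ?mulr_gt0 ?invr_gt0 ?exprn_gt0 // ln2k.
  rewrite lnM ?posrE ?invr_gt0 // LE -natr1 => /ltW.
  rewrite -(ler_pM2l al2) (_ : a / ln 2 * ((k%:R + 1) * ln 2) = (k%:R + 1) * a).
    by rewrite /B; lra.
  by rewrite mulrCA divfK // gt_eqF.
have [N0 low] := lower.
have up : ln (Ndelta d F)%:R <= ln A + (L + a / ln 2 * L).
  have [k kd] : exists k : nat, 2 ^+ k <= d^-1 < 2 ^+ k.+1.
    by apply: dyadic_scale; rewrite invf_ge1.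
  have := Ndelta_attractor_upper R l d F k l2 l1 d0 Fsq FE kd; rewrite -/A.
  move=> hN; apply: (@le_trans _ _ (ln (A / d * (2 * l) ^+ k))).
    by rewrite ler_ln ?posrE // !mulr_gt0 ?invr_gt0.
  rewrite lnM ?posrE ?mulr_gt0 ?invr_gt0 // lnM ?posrE ?invr_gt0 // LE lnq.
  rewrite -addrA !lerD2l.
  case/andP: kd => + _; rewrite -ler_ln ?posrE ?invr_gt0 ?exprn_gt0 // ln2k LE.
  rewrite -(ler_pM2l al2); apply: le_trans.
  by rewrite mulrCA divfK // gt_eqF.
have := ler_norm (ln A); have := ler_norm (- B); rewrite normrN; have := ler_norm B.
have := normr_ge0 B; have := normr_ge0 (ln A).
have -> : ln d = - L by rewrite opprK.
by rewrite ler_norml; lra.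
Unshelve. all: by end_near.
Qed.
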